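(* Let $n=p^\tau$ with integers $p\ge2$ and $\tau\ge1$. Let $W_{\mathrm{db}}\in\mathbb R^{n\times n}$ be the weight matrix of the de Bruijn graph and let $\{W_{\mathrm{hc}}^{(l)}\}_{l\in\mathbb N}\subset\mathbb R^{n\times n}$ be the weight matrices of the $p$-peer hyper-cuboids (for the factorization $n=p\cdot p\cdots p$). Then, for any $l\in\mathbb N$, there exist $n\times n$ permutation matrices $P^{(l)}$ and $Q^{(l)}$ such that $$W_{\mathrm{hc}}^{(l)}=P^{(l)}\,W_{\mathrm{db}}\,(Q^{(l)})^{\mathsf T}.$$
   Context: $\mathbb N=\{0,1,2,\dots\}$; $\mathrm{mod}(a,m)\in\{0,\dots,m-1\}$ is the remainder of $a$ modulo $m$; rows and columns of $n\times n$ matrices are indexed by $0,1,\dots,n-1$. For $i\in\{0,\dots,n-1\}$ write its base-$p$ representation as $(i_{\tau-1}i_{\tau-2}\dots i_0)_p$, with digits in $\{0,\dots,p-1\}$. de Bruijn graph: $W_{\mathrm{db}}=[w_{ij}]$ with $w_{ij}=\frac1p$ if $(i_{\tau-2}i_{\tau-3}\dots i_0)_p=(j_{\tau-1}j_{\tau-2}\dots j_1)_p$ and $w_{ij}=0$ otherwise (for $\tau=1$ the condition is vacuous). $p$-peer hyper-cuboids for $n=p^\tau$: $W_{\mathrm{hc}}^{(l)}=[w^{(l)}_{ij}]$ where, with $r=\mathrm{mod}(l,\tau)$, $w^{(l)}_{ij}=\frac1p$ if the base-$p$ representations of $i$ and $j$ differ in the $r$-th digit (digit $i_r$ versus $j_r$)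 and agree in all other digits; $w^{(l)}_{ij}=\frac1p$ if $i=j$; and $w^{(l)}_{ij}=0$ otherwise. *)

(* Defs.v *)
From HB Require Import structures.
From mathcomp Require Import all_boot all_order all_algebra.

Set Implicit Arguments.
Unset Strict Implicit.
Unset Printing Implicit Defensive.

Import GRing.Theory.
Local Open Scope ring_scope.

(* [digit p i k] is the base-p digit i_k of i; k = 0 is the least significant. *)
Definition digit (p i k : nat) : nat := ((i %/ p ^ k) %% p)%N.

(* The number (d_{t-1} ... d_1 d_0)_p; for t = 0 it is the empty word, 0. *)
Definition of_digits (p t : nat) (d : nat -> nat) : nat :=
  (\sum_(k < t) d k * p ^ k)%N.

Lemma ltn_digit (p i k : nat) : (0 < p)%N -> (digit p i k < p)%N.
Proof. exact: ltn_pmod. Qed.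

Lemma of_digits_digit (p t i : nat) :
  (i < p ^ t)%N -> of_digits p t (digit p i) = i.
Proof.
rewrite /of_digits => lti; rewrite -[RHS](modn_small lti); elim: t {lti} => [|t IH].
  by rewrite big_ord0 modn1.
rewrite big_ord_recr /= IH /digit modn_divl -expnS.
set q := (p ^ t)%N.
rewrite {2}(divn_eq (i %% p ^ t.+1) q) addnC; congr (_ + _)%N.
by rewrite modn_dvdm // dvdn_exp2l.
Qed.

(* For tau = 1 both sides of the test are the empty word, so it always holds. *)
Definition W_db (R : realFieldType) (p tau : nat) : 'M[R]_(p ^ tau) :=
  \matrix_(i, j)
    if of_digits p tau.-1 (digit p i)
         == of_digits p tau.-1 (fun k => digit p j k.+1)
    then p%:R^-1 else 0.

Definition W_hc (R : realFieldType) (p tau l : nat) : 'M[R]_(p ^ tau) :=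
  let r := (l %% tau)%N in
  \matrix_(i, j)
    if (digit p i r != digit p j r)
         && [forall k : 'I_tau, (k != r :> nat) ==> (digit p i k == digit p j k)]
    then p%:R^-1
    else if i == j then p%:R^-1 else 0.

(* Main.v *)
(* After permuting indices on both sides, an entry of [W_db] compares the lower
   tau - 1 digits of the row index with the upper tau - 1 digits of the column
   index.  Relabelling the rows by moving the r-th digit to the top, and the
   columns by moving the r-th digit to the bottom, turns this into comparing all
   digits but the r-th, which is the condition defining [W_hc]. *)
Require Import Defs.
From HB Require Import structures.
From mathcomp Require Import all_boot all_order all_algebra all_fingroup.

Set Implicit Arguments.
Unset Strict Implicit.
Unset Printing Implicit Defensive.

Import GRing.Theory.
Local Open Scope ring_scope.

Lemma ltn_of_digits (p t : nat) (d : nat -> nat) :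
  (forall k, (k < t)%N -> (d k < p)%N) -> (of_digits p t d < p ^ t)%N.
Proof.
rewrite /of_digits; elim: t => [|t IH] dp; first by rewrite big_ord0.
rewrite big_ord_recr /= expnS.
have lt_t : (\sum_(k < t) d k * p ^ k < p ^ t)%N.
  by apply: IH => k kt; apply: dp; rewrite ltnW.
by apply: leq_trans (leq_mul (dp t (ltnSn t)) (leqnn _)); rewrite mulSn ltn_add2r.
Qed.

Lemma digit_of_digits (p t : nat) (d : nat -> nat) (k : nat) :
  (0 < p)%N -> (forall k, (k < t)%N -> (d k < p)%N) -> (k < t)%N ->
  digit p (of_digits p t d) k = d k.
Proof.
move=> p0; elim: t => [|t IH] // dp; rewrite ltnS leq_eqVlt.
have dp' k' : (k' < t)%N -> (d k' < p)%N by move=> k't; apply: dp; rewrite ltnW.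
have -> : of_digits p t.+1 d = (d t * p ^ t + of_digits p t d)%N.
  by rewrite /of_digits big_ord_recr addnC.
case/predU1P=> [-> | kt].
  rewrite /digit divnMDl ?expn_gt0 ?p0 // divn_small ?ltn_of_digits //.
  by rewrite addn0 modn_small ?dp.
(* Since [k < t], the leading term [d t * p ^ t] is a multiple of [p ^ k.+1]: divided by [p ^ k] it
   vanishes modulo [p]. *)
rewrite -[RHS](IH dp' kt) /digit -(subnK kt) addnS -addSn expnD mulnA.
by rewrite divnMDl ?expn_gt0 ?p0 // expnSr mulnA modnMDl.
Qed.

Lemma eq_of_digits (p t : nat) (d e : nat -> nat) :
  (0 < p)%N -> (forall k, (d k < p)%N) -> (forall k, (e k < p)%N) ->
  (of_digits p t d == of_digits p t e) = [forall k : 'I_t, d k == e k].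
Proof.
move=> p0 dp ep; apply/eqP/forallP => [de k | de].
  rewrite -(@digit_of_digits p t d) // de digit_of_digits //.
by apply: eq_bigr => k _; rewrite (eqP (de k)).
Qed.

Lemma eq_digits (p t : nat) (i j : 'I_(p ^ t)) :
  (forall k : 'I_t, digit p i k = digit p j k) -> i = j.
Proof.
move=> eij; apply: val_inj; rewrite /= -(of_digits_digit (ltn_ord i)).
rewrite -[RHS](of_digits_digit (ltn_ord j)).
by apply: eq_bigr => k _; rewrite eij.
Qed.

(** Supplies the relabellings of rows and columns. Injectivity holds because reading the new digits
    through the inverse of [s] recovers the old ones. *)
Lemma digit_perm (p t : nat) (s : 'S_t) : (0 < p)%N ->
  exists f : 'S_(p ^ t),
    forall (i : 'I_(p ^ t)) (k : 'I_t), digit p (f i) k = digit p i (s k).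
Proof.
(* [of_digits] wants a digit function on all of [nat]; the default position 0 is only used for
   [k >= t]. *)
move=> p0; pose d (i k : nat) := digit p i (oapp (fun k => val (s k)) 0%N (insub k)).
have dp i k : (d i k < p)%N by apply: ltn_digit.
pose f (i : 'I_(p ^ t)) := Ordinal (@ltn_of_digits p t (d i) (fun k _ => dp i k)).
have fE i (k : 'I_t) : digit p (f i) k = digit p i (s k).
  by rewrite digit_of_digits // /d valK.
have f_inj : injective f.
  move=> i j fij; apply: eq_digits => k.
  by rewrite -(permKV s k) -!fE fij.
by exists (perm f_inj) => i k; rewrite permE.
Qed.

(** The two nonzero cases merge: when the other digits agree, either the [r]-th digits differ or
    [i = j]. *)
Lemma W_hcE (R : realFieldType) (p t l : nat) (i j : 'I_(p ^ t.+1)) :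
  let r : 'I_t.+1 := inord (l %% t.+1) in
  W_hc R p t.+1 l i j =
    if [forall k : 'I_t, digit p i (lift r k) == digit p j (lift r k)]
    then p%:R^-1 else 0.
Proof.
move=> r; have rE : r = (l %% t.+1)%N :> nat by rewrite inordK ?ltn_mod.
rewrite mxE -rE.
have -> : [forall k : 'I_t.+1, (k != r :> nat) ==> (digit p i k == digit p j k)]
    = [forall k : 'I_t, digit p i (lift r k) == digit p j (lift r k)].
  apply/forallP/forallP => eij k.
    by move: (eij (lift r k)); rewrite eq_sym neq_lift.
  by case: (unliftP r k) => [k' ->|->]; rewrite ?eqxx // eij implybT.
case: eqP => [eqr | neqr] /=; last first.
  by case: ifP => // _; case: eqP => // eij; case: neqr; rewrite eij.
congr (if _ then _ else _); apply/eqP/forallP => [-> //| eij].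
apply: eq_digits => k; case: (unliftP r k) => [k' ->|-> //].
exact/eqP/eij.
Qed.

Lemma W_dbE (R : realFieldType) (p t : nat) (i j : 'I_(p ^ t.+1)) : (0 < p)%N ->
  W_db R p t.+1 i j =
    if [forall k : 'I_t, digit p i (lift ord_max k) == digit p j (lift ord0 k)]
    then p%:R^-1 else 0.
Proof.
move=> p0; rewrite mxE eq_of_digits // => [|k|k]; try exact: ltn_digit.
by under [in RHS]eq_forallb => k do rewrite lift_max lift0.
Qed.

Theorem proposition3p5 (R : realFieldType) (p tau : nat)
    (hp : (2 <= p)%N) (htau : (1 <= tau)%N) (l : nat) :
  exists P Q : 'M[R]_(p ^ tau),
    [/\ is_perm_mx P, is_perm_mx Q & W_hc R p tau l = P *m W_db R p tau *m Q^T].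
Proof.
have p0 : (0 < p)%N by apply: ltnW.
case: tau htau => // t _.
pose r : 'I_t.+1 := inord (l %% t.+1).
(* This permutation sends the top position to [r] and [lift ord_max k] to [lift r k], so [f i]
   carries digit [r] of [i] on top; [g] puts it at the bottom. *)
have [f fE] := digit_perm (lift_perm ord_max r 1) p0.
have [g gE] := digit_perm (lift_perm ord0 r 1) p0.
exists (perm_mx f), (perm_mx g); split; try exact: perm_mx_is_perm.
(* The product becomes a reindexing, with [(i, j)] entry that of [W_db] at [(f i, g j)]. *)
rewrite tr_perm_mx -row_permE -col_permE.
apply/matrixP => i j; rewrite W_hcE [RHS]mxE [RHS]mxE W_dbE //.
congr (if _ then _ else _); apply: eq_forallb => k.
by rewrite fE gE !lift_perm_lift !perm1.
Qed.
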